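(* For every $k,d \in \mathbb{N}$ with $d \geq 2$, there exists an effective constant $C_{k,d} > 0$ (depending only on $k$ and $d$) such that for every $\alpha \in \mathbb{R}$ and $n \in \mathbb{N}$ there exist integers $1 \leq b_{1},\ldots,b_{k}\leq n$ with $$\left\|\sum_{j=1}^{k}\sqrt[d]{b_{j}} - \alpha \right\| \leq C_{k,d}\cdot n^{-\gamma(k,d)},$$ where $$\gamma(k,d) = \frac{d^{\lfloor \log_{d}(k+1)\rfloor}-1}{d} \geq \frac{k-d+1}{d^2}.$$
   Context: $\mathbb{N}=\{1,2,\ldots\}$. For real $x$, $\|x\| := \min_{m\in\mathbb{Z}}|x-m|$ denotes the distance to the nearest integer, $\lfloor x\rfloor$ is the floor of $x$, and $\log_d$ is the logarithm to base $d$. ''Effective'' means that the constant can in principle be computed explicitly. *)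

(* Defs.v *)
From mathcomp Require Import all_boot all_order all_algebra.
From mathcomp Require Import all_classical all_reals all_analysis.

Set Implicit Arguments.
Unset Strict Implicit.
Unset Printing Implicit Defensive.

Import Order.TTheory GRing.Theory Num.Theory.

(* Kleene's recursive functions, as a predicate on total functions.  The
   minimization clause only applies when the search always succeeds (regular
   minimization); by Kleene's normal form theorem this still yields all total
   recursive functions. *)
Inductive recursive : forall n, (n.-tuple nat -> nat) -> Prop :=
| recursive_zero n : @recursive n (fun=> 0)
| recursive_succ : @recursive 1 (fun v => (thead v).+1)
| recursive_proj n (i : 'I_n) : @recursive n (fun v => tnth v i)
| recursive_comp m n (f : m.-tuple nat -> nat)
    (g : 'I_m -> n.-tuple nat -> nat) :
    recursive f -> (forall i, recursive (g i)) ->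
    @recursive n (fun v => f [tuple g i v | i < m])
| recursive_primrec n (f : n.-tuple nat -> nat) (g : n.+2.-tuple nat -> nat)
    (h : n.+1.-tuple nat -> nat) :
    recursive f -> recursive g ->
    (forall v : n.-tuple nat, h (cons_tuple 0 v) = f v) ->
    (forall y (v : n.-tuple nat),
       h (cons_tuple y.+1 v) =
         g (cons_tuple y (cons_tuple (h (cons_tuple y v)) v))) ->
    recursive h
| recursive_min n (g : n.+1.-tuple nat -> nat) (h : n.-tuple nat -> nat) :
    recursive g ->
    (forall v : n.-tuple nat, g (cons_tuple (h v) v) = 0) ->
    (forall (v : n.-tuple nat) y, y < h v -> g (cons_tuple y v) <> 0) ->
    recursive h.

Local Open Scope classical_set_scope.
Local Open Scope ring_scope.

(* A two-parameter family of constants is effective when some algorithm, given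
   the parameters k, d and a precision m, outputs a rational number (encoded as
   (p - q) / (m + 1) with p, q natural) within 1 / (m + 1) of C k d. *)
Definition effective (R : realType) (C : nat -> nat -> R) : Prop :=
  exists p q : 3.-tuple nat -> nat,
    [/\ recursive p, recursive q &
      forall k d m : nat,
        `|C k d - ((p [tuple k; d; m])%:R - (q [tuple k; d; m])%:R) / m.+1%:R|
          <= m.+1%:R^-1].

Definition dist_int (R : realType) (x : R) : R :=
  inf [set `|x - m%:~R| | m in [set: int]].

(* The infimum is attained, so dist_int is the minimum over the integers. *)
Lemma dist_int_min (R : realType) (x : R) :
  (exists m : int, dist_int x = `|x - m%:~R|) /\
  (forall m : int, dist_int x <= `|x - m%:~R|).
Proof.
have lb (m : int) : Num.min `|x - (Num.floor x)%:~R|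
    `|x - (Num.floor x + 1)%:~R| <= `|x - m%:~R|.
  have fx : (Num.floor x)%:~R <= x by exact: floor_le.
  have xf : x < (Num.floor x + 1)%:~R by exact: floorD1_gt.
  rewrite ge_min; have [mf|fm] := leP m (Num.floor x).
    have mfR : m%:~R <= (Num.floor x)%:~R :> R by rewrite ler_int.
    have mx := le_trans mfR fx.
    rewrite (@ger0_norm _ (x - (Num.floor x)%:~R)) ?subr_ge0//.
    by rewrite (@ger0_norm _ (x - m%:~R)) ?subr_ge0// lerB.
  have mfR : (Num.floor x + 1)%:~R <= m%:~R :> R by rewrite ler_int lezD1.
  rewrite (distrC x m%:~R) (distrC x (_ + 1)%:~R).
  apply/orP; right.
  have xm := le_trans (ltW xf) mfR.
  rewrite (@ger0_norm _ ((_ + 1)%:~R - x)) ?subr_ge0 ?(ltW xf)//.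
  by rewrite (@ger0_norm _ (m%:~R - x)) ?subr_ge0// lerB.
have lbd (m : int) : dist_int x <= `|x - m%:~R|.
  by apply: ge_inf; [exists 0 => _ [j _ <-] | exists m].
split=> //.
have [m hm] : exists m : int, `|x - m%:~R| =
    Num.min `|x - (Num.floor x)%:~R| `|x - (Num.floor x + 1)%:~R|.
  by rewrite minEle; case: ifP => _; [exists (Num.floor x)|eexists].
exists m; apply/eqP; rewrite eq_le lbd /=.
apply: lb_le_inf; first by exists `|x - m%:~R|, m.
by move=> _ [j _ <-]; rewrite hm.
Qed.

Definition logb (R : realType) (b x : R) : R := ln x / ln b.

Definition gamma (R : realType) (k d : nat) : R :=
  (d%:R ^ Num.floor (logb d%:R k.+1%:R : R) - 1) / d%:R.

(* Main.v *)
Require Import Defs.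
From HB Require Import structures.
From mathcomp Require Import all_boot all_order all_fingroup all_algebra.
From mathcomp Require Import all_classical all_reals all_analysis.
From mathcomp Require Import zify ring lra.

Set Implicit Arguments.
Unset Strict Implicit.
Unset Printing Implicit Defensive.

Import Order.TTheory GRing.Theory Num.Theory.
Local Open Scope ring_scope.

(** Put t = floor (log_d (k + 1)) and N = d ^ t.  The idea is to produce N real
    numbers w, one of them equal to 1 and all of them d-th roots of positive
    integers, that form a basis of a number field of degree N.  If c is a
    positive integer then c * r ^ (1 / d) is the d-th root of c ^ d * r, so a
    sum of d-th roots may be any combination of the N - 1 irrational w with
    positive integer coefficients of size about X = n ^ (1 / d), and the task
    is to bring such a combination, modulo 1, within a constant multiple of
    X ^ - (N - 1) = n ^ - gamma of alpha.

    The field structure makes this easy ([inhomogeneous]).  By the pigeonhole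
    principle ([dirichlet]) there is a nonzero integer combination beta of the
    w, with coefficients O(X), such that |beta| <= X ^ - (N - 1).  The products
    beta * w_i are again integer combinations with coefficients O(X) and value
    O(X ^ - (N - 1)).  As beta is invertible in the field, these N coefficient
    vectors are linearly independent, hence span a lattice whose fundamental
    cell is small both in the coefficients and in the value of the linear form:
    every real alpha is approximated by a lattice point.  A translation by a
    multiple of X makes all coefficients positive.

    For w we take the d-th roots of the products of powers, with exponents
    below d, of t distinct primes p > d.  Their linear independence is proved by
    adjoining one root tau of p at a time ([Zfree_adjoin_root]).  Suppose that
    the sum of the g_a * tau ^ a, a < d, vanishes, where the g_a lie in the
    order L spanned by the previous radicals.  The determinant of the
    multiplication by this sum is congruent to g_0 ^ d modulo p L, so that p
    divides g_0 ^ d.  Now L / p L is reduced: the Frobenius map sends the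
    radicals to unit multiples of distinct radicals.  Hence p divides g_0; then
    dividing by tau rotates the coefficients, and repeating this shows that
    every coefficient is divisible by all powers of p.

    The primes are found among the divisors of s + 1, with s the product of d!
    and the primes already chosen.  This bounds them explicitly, and yields a
    constant built from k and d by additions, multiplications and powers. *)

(** * Pigeonhole and inhomogeneous approximation *)

Definition Zfree (R : pzRingType) (I : finType) (w : I -> R) :=
  forall c : I -> int, \sum_i (c i)%:~R * w i = 0 -> forall i, c i = 0.

(** Among the (X + 1) ^ (#|I| - 1) combinations with coefficients in [0, X]
    outside i0, two have fractional parts in the same of X ^ (#|I| - 1) boxes;
    the coefficient at i0 absorbs the difference of the integer parts. *)
Lemma dirichlet (R : realType) (I : finType) (i0 : I) (w : I -> R) (X : nat) :
  w i0 = 1 -> (0 < X)%N ->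
  exists c : I -> int,
    [/\ exists i, c i != 0, forall i, i != i0 -> `|c i| <= X%:Z
      & `|\sum_i (c i)%:~R * w i| <= X%:R ^- #|predC1 i0| ].
Proof.
move=> w1 X0; set K := #|_|.
have sum_i0 (m : int) : \sum_i (m *+ (i == i0))%:~R * w i = m%:~R.
  rewrite (bigD1 i0)//= eqxx w1 mulr1 big1 ?addr0// => i /negPf ->.
  by rewrite mulr0n mul0r.
(* Without other index than i0, the pigeonhole argument is void. *)
have [K0|K0] := posnP K.
  exists (fun i => 1%:Z *+ (i == i0)); split.
  - by exists i0; rewrite eqxx.
  - by move=> i /negPf ->; rewrite normr0.
  - by rewrite sum_i0 normr1 K0 expr0 invr1.
pose S (f : {ffun I -> 'I_X.+1}) : R := \sum_i (f i)%:R * w i.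
pose D :=
  [pred f : {ffun I -> 'I_X.+1} | f \in pffun_on ord0 (predC1 i0) predT].
have XK0 : 0 < (X ^ K)%:R :> R by rewrite ltr0n expn_gt0 X0.
pose frac x : R := x - (Num.floor x)%:~R.
have frac_itv x : 0 <= frac x < 1.
  by rewrite /frac subr_ge0 ltrBlDl -(intrD1) floor_itv.
have box_lt f : (Num.truncn ((X ^ K)%:R * frac (S f)) < X ^ K)%N.
  have /andP[f0 f1] := frac_itv (S f).
  by rewrite truncn_lt_nat ?mulr_ge0// gtr_pMr.
pose box f := Ordinal (box_lt f).
have : ~~ dinjectiveb box D.
  apply/negP => /dinjectiveP /leq_card_in.
  by rewrite card_ord card_pffun_on card_ord -/K leq_exp2r// ltnn.
case/dinjectivePn => f fD [g /andP[gf gD] [eqfg]].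
have Di0 h : h \in D -> h i0 = ord0.
  move=> /pffun_onP[/fintype.subsetP hs _]; apply/eqP/negPn/negP => hi0.
  by have := hs i0 hi0; rewrite inE eqxx.
exists (fun i => (f i)%:Z - (g i)%:Z -
  (Num.floor (S f) - Num.floor (S g)) *+ (i == i0)).
split.
- have [i fgi] : exists i, f i != g i.
    apply/existsP; apply: contraR gf; rewrite negb_exists => /forallP fg.
    by apply/eqP/ffunP => i; have /eqP := negbNE (fg i).
  exists i; have -> : (i == i0) = false.
    by apply: contraNF fgi => /eqP ->; rewrite !Di0.
  by rewrite subr0 subr_eq0.
- move=> i /negPf ->; rewrite subr0 ler_norml.
  by have := ltn_ord (f i); have := ltn_ord (g i); lia.
- under eq_bigr do rewrite intrB mulrBl intrB mulrBl.
  rewrite !sumrB sum_i0 -!/(S _) rmorphB /=.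
  have -> : S f - S g - ((Num.floor (S f))%:~R - (Num.floor (S g))%:~R) =
    frac (S f) - frac (S g) by rewrite /frac; ring.
  have /andP[f0 _] := frac_itv (S f); have /andP[g0 _] := frac_itv (S g).
  rewrite -[_^-1]mul1r ler_pdivlMr ?exprn_gt0 ?ltr0n// -natrX.
  have /truncn_itv /andP[] := mulr_ge0 (ltW XK0) f0.
  have /truncn_itv /andP[] := mulr_ge0 (ltW XK0) g0.
  rewrite eqfg -(gtr0_norm XK0) -normrM (gtr0_norm XK0) -!natr1.
  by move=> *; rewrite ler_norml; apply/andP; split; lra.
Qed.

Section Inhomogeneous.
Variables (R : realType) (N : nat) (i0 : 'I_N) (w : 'I_N -> R) (W : nat).
Hypothesis w_i0 : w i0 = 1.
Hypothesis w_bounds : forall i, 1 <= w i <= W%:R.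
Hypothesis w_closed :
  forall i j, exists l (m : nat), w i * w j = m%:R * w l.
Hypothesis w_free : Zfree w.

(** Multiplication by an element of the order is an integer matrix; the
    structure constants are at most W ^ 2 because w i * w j <= W ^ 2 and
    every w l is at least 1. *)
Lemma mulmatrix (c : 'I_N -> int) (H : nat) : (forall i, `|c i| <= H%:Z) ->
  exists M : 'M[int]_N,
    (forall i l, `|M i l| <= (N * (H * W ^ 2))%N%:Z) /\
    forall i, (\sum_j (c j)%:~R * w j) * w i = \sum_l (M i l)%:~R * w l.
Proof.
move=> cH; pose x i j :=
  xget (i0, 0%N) [set p : 'I_N * nat | w i * w j = p.2%:R * w p.1].
have xP i j : w i * w j = (x i j).2%:R * w (x i j).1.
  rewrite /x; case: xgetP => [y _ //|] noy.
  by have [l [m wm]] := w_closed i j; case: (noy (l, m)).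
have x_le i j : ((x i j).2 <= W ^ 2)%N.
  rewrite -(ler_nat R) natrX expr2.
  have /andP[w1 _] := w_bounds (x i j).1.
  have /andP[wi wiW] := w_bounds i; have /andP[wj wjW] := w_bounds j.
  apply: (@le_trans _ _ (w i * w j)).
    by rewrite xP ler_peMr ?ler0n.
  by rewrite ler_pM // (le_trans ler01).
exists (\matrix_(i, l) \sum_(j | (x j i).1 == l) c j * (x j i).2%:Z).
split=> [i l|i].
  rewrite mxE (le_trans (ler_norm_sum _ _ _))//.
  apply: (@le_trans _ _ (\sum_(j : 'I_N) (H * W ^ 2)%N%:Z)).
    rewrite big_mkcond /=; apply: ler_sum => j _; case: ifP => // _.
    by rewrite normrM PoszM ler_pM ?normr_ge0 ?cH// lez_nat x_le.
  by rewrite sumr_const card_ord PoszM -mulr_natl natz.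
rewrite mulr_suml; under [RHS]eq_bigr do rewrite mxE rmorph_sum /= mulr_suml.
rewrite (exchange_big_dep xpredT)//=; apply: eq_bigr => j _.
rewrite (big_pred1 (x j i).1); last by move=> l; rewrite eq_sym.
by rewrite intrM -mulrA -mulrA xP.
Qed.

(** The rows of the matrix of multiplication by a small beta are lattice vectors
    on which both the coefficients and the linear form are small.  Writing the
    real vector (alpha, 0, ..., 0) on this basis and rounding its coordinates
    down moves it by a bounded number of such rows. *)
Lemma inhomogeneous (X : nat) (alpha : R) : (0 < X)%N ->
  exists c : 'I_N -> int,
    (forall i, i != i0 -> `|c i| <= (N ^ 3 * W ^ 3 * X)%N%:Z) /\
    `|\sum_i (c i)%:~R * w i - alpha| <= (N * W)%:R * X%:R ^- #|predC1 i0|.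
Proof.
move=> X0; have [c [[j cj] cX betaX]] := dirichlet w_i0 X0.
set e := _ ^- _ in betaX *; set beta := \sum_i _ in betaX.
have wpos i : 0 < w i by have /andP[/(lt_le_trans ltr01)] := w_bounds i.
have beta0 : beta != 0 by apply: contraNneq cj => /w_free ->.
have e1 : e <= 1.
  by rewrite invf_le1 ?exprn_ege1 ?exprn_gt0 ?ler1n ?ltr0n.
(* The coefficient at i0 is controlled by the others, since beta is small. *)
have cH i : `|c i| <= (N * W * X)%N%:Z.
  have WX1 : (X <= W * X)%N.
    rewrite leq_pmull// -(ltr_nat R).
    have /andP[w1 wW] := w_bounds i0; lra.
  have N1 : (1 <= N)%N by case: (N) i0 => // -[].
  have [->|ii0] := eqVneq i i0; last first.
    apply: le_trans (cX i ii0) _; rewrite lez_nat -mulnA.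
    by rewrite (leq_trans WX1)// leq_pmull.
  rewrite -(ler_int R) intr_norm.
  have -> : (c i0)%:~R = beta - \sum_(i | i != i0) (c i)%:~R * w i.
    by rewrite /beta (bigD1 i0)//= w_i0 mulr1 addrK.
  rewrite (le_trans (ler_normB _ _))//.
  apply: (@le_trans _ _ (1 + \sum_(i | i != i0) (W * X)%:R)).
    rewrite lerD ?(le_trans betaX)// (le_trans (ler_norm_sum _ _ _))//.
    apply: ler_sum => l li0; rewrite normrM natrM mulrC (gtr0_norm (wpos l)).
    have /andP[_ wW] := w_bounds l.
    rewrite ler_pM ?(ltW (wpos l))//.
    by rewrite -intr_norm (ler_int R _ X%:Z) cX.
  rewrite sumr_const cardC1 card_ord -mulnA -{2}(prednK N1) mulSn.
  rewrite -mulrnA [_%:~R]/= -[_%:~R]pmulrn natrD mulnC lerD// ler1n.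
  exact: leq_trans X0 WX1.
have [M [MH Mw]] := mulmatrix cH; rewrite -/beta in Mw.
(* An integer row killed by M is an element v of the order with beta * v = 0. *)
have detM : \det M != 0.
  apply/negP => /det0P[v v0 vM]; case/negP: v0; apply/eqP/rowP => i.
  rewrite mxE; apply: w_free; apply: (mulfI beta0).
  rewrite mulr0 mulr_sumr.
  under eq_bigr do rewrite mulrCA Mw mulr_sumr.
  rewrite exchange_big big1//= => l _.
  have /rowP/(_ l) := vM; rewrite !mxE => vMl.
  under eq_bigr do rewrite mulrA -intrM.
  by rewrite -mulr_suml -rmorph_sum/= vMl mul0r.
pose A : 'M[R]_N := map_mx intr M.
have Au : A \in unitmx by rewrite unitmxE det_map_mx unitfE intr_eq0.
pose a : 'rV[R]_N := \row_l (alpha *+ (l == i0)).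
pose u := a *m invmx A.
have uA l : \sum_i u 0 i * (M i l)%:~R = alpha *+ (l == i0).
  have /rowP/(_ l) := mulmxKV Au a; rewrite !mxE => <-.
  by apply: eq_bigr => i _; rewrite [A i l]mxE.
pose r i := u 0 i - (Num.floor (u 0 i))%:~R.
have r01 i : 0 <= r i <= 1.
  have /andP[fl lf] := floor_itv (u 0 i).
  by rewrite subr_ge0 lerBlDl -intrD1 fl ltW.
exists (fun l => \sum_i Num.floor (u 0 i) * M i l).
have cE l : (\sum_i Num.floor (u 0 i) * M i l)%:~R =
    alpha *+ (l == i0) - \sum_i r i * (M i l)%:~R.
  rewrite -uA -sumrB rmorph_sum /=; apply: eq_bigr => i _.
  by rewrite /r intrM; ring.
split=> [l /negPf li0|].
  rewrite -(ler_int R) intr_norm cE li0 sub0r normrN.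
  rewrite (le_trans (ler_norm_sum _ _ _))//.
  apply: (@le_trans _ _ (\sum_(i : 'I_N) (N * (N * W * X * W ^ 2))%:R)).
    apply: ler_sum => i _; have /andP[r0 r1] := r01 i.
    rewrite normrM (ger0_norm r0) -[leRHS]mul1r ler_pM//.
    by rewrite -intr_norm (ler_int R _ (Posz _)).
  rewrite sumr_const card_ord -mulrnA -[leRHS]pmulrn ler_nat.
  by rewrite eq_leq//; ring.
under eq_bigr do rewrite cE mulrBl.
rewrite sumrB (bigD1 i0)//= eqxx w_i0 mulr1 big1;
  last by move=> l /negPf ->; rewrite mul0r.
under eq_bigr do rewrite mulr_suml.
rewrite exchange_big addr0 addrC addKr normrN.
have -> : \sum_i \sum_l r i * (M i l)%:~R * w l = \sum_i r i * (beta * w i).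
  apply: eq_bigr => i _; rewrite Mw mulr_sumr.
  by apply: eq_bigr => l _; rewrite mulrA.
rewrite (le_trans (ler_norm_sum _ _ _))//.
apply: (@le_trans _ _ (\sum_(i : 'I_N) (e * W%:R))); last first.
  by rewrite sumr_const card_ord -mulr_natl natrM; lra.
apply: ler_sum => i _; have /andP[r0 r1] := r01 i.
rewrite !normrM (ger0_norm r0) (gtr0_norm (wpos i)) -[leRHS]mul1r.
have /andP[_ wW] := w_bounds i.
by rewrite ler_pM ?mulr_ge0 ?(ltW (wpos i))// ler_pM ?(ltW (wpos i)).
Qed.

End Inhomogeneous.

(** * Linear independence of radicals *)

Section MultiplesInSubring.
Variables (R : comNzRingType) (L : subringClosed R) (p : nat).

Definition multiples : {pred R} :=
  fun x => `[< exists2 y, y \in L & x = p%:R * y >].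

Lemma multiplesP x :
  reflect (exists2 y, y \in L & x = p%:R * y) (x \in multiples).
Proof. exact: asboolP. Qed.

Fact multiples_zmod_closed : zmod_closed multiples.
Proof.
split=> [|x y /multiplesP[x' Lx ->] /multiplesP[y' Ly ->]]; apply/multiplesP.
  by exists 0; rewrite ?rpred0 ?mulr0.
by exists (x' - y'); rewrite ?rpredB ?mulrBr.
Qed.
HB.instance Definition _ :=
  GRing.isZmodClosed.Build R multiples multiples_zmod_closed.

Lemma multiplesMl x y : x \in L -> y \in multiples -> x * y \in multiples.
Proof.
move=> Lx /multiplesP[z Lz ->]; apply/multiplesP; exists (x * z).
  exact: rpredM.
by rewrite mulrCA.
Qed.

Lemma multiples_natmul x : x \in L -> p%:R * x \in multiples.
Proof. by move=> Lx; apply/multiplesP; exists x. Qed.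

Hypothesis p_pr : prime p.

(** The inner binomial coefficients of exponent p are divisible by p. *)
Lemma frobenius_add x y : x \in L -> y \in L ->
  (x + y) ^+ p - (x ^+ p + y ^+ p) \in multiples.
Proof.
move=> Lx Ly; have p0 := prime_gt0 p_pr.
rewrite exprDn (bigD1 ord0)//= (bigD1 ord_max)/=; last by rewrite -val_eqE /= -lt0n.
rewrite subn0 subnn !expr0 mulr1 mul1r bin0 binn !mulr1n.
rewrite addrA [_ + \sum_(_ | _) _]addrC addrK.
apply: rpred_sum => i /andP[i0 ip].
have /dvdnP[m ->] : (p %| 'C(p, i))%N.
  apply: prime_dvd_bin => //; rewrite lt0n i0 ltn_neqAle -ltnS ltn_ord andbT.
  by move: ip; rewrite -val_eqE.
rewrite mulrnA -mulr_natl.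
apply: multiples_natmul.
by rewrite rpredMn// rpredM ?rpredX.
Qed.

Lemma frobenius_sum (I : finType) (x : I -> R) : (forall i, x i \in L) ->
  (\sum_i x i) ^+ p - \sum_i x i ^+ p \in multiples.
Proof.
move=> Lx; elim: (index_enum I) => [|i s IHs].
  by rewrite !big_nil expr0n eqn0Ngt prime_gt0// subr0 rpred0.
rewrite !big_cons.
have Ls : \sum_(j <- s) x j \in L by rewrite rpred_sum.
rewrite (_ : _ - _ = (x i + \sum_(j <- s) x j) ^+ p
    - (x i ^+ p + (\sum_(j <- s) x j) ^+ p)
    + ((\sum_(j <- s) x j) ^+ p - \sum_(j <- s) x j ^+ p)); last by ring.
by rewrite rpredD ?frobenius_add.
Qed.

End MultiplesInSubring.

(** By strong induction on i: if s never increases, it fixes every index below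
    i, so by injectivity s i cannot be below i either. *)
Lemma perm_neq1_gt n (s : 'S_n) : s != 1%g -> exists i : 'I_n, (i < s i)%N.
Proof.
move=> s1; apply/existsP; apply: contraR s1; rewrite negb_exists => /forallP s_le.
apply/eqP/permP => i; rewrite perm1.
have [k] := ubnP i; elim: k i => // k IHk i ik.
have := s_le i; rewrite -leqNgt leq_eqVlt => /orP[/eqP/val_inj//|si].
by have /perm_inj := IHk (s i) (leq_trans si ik).
Qed.

(** Multiplication by the sum of the g a * tau ^ a acts on the powers of tau by a
    matrix that is triangular modulo p with g 0 on the diagonal; if the sum is
    zero then the vector of powers of tau shows that the determinant vanishes. *)
Lemma const_coef_exp_multiple (R : idomainType) (L : subringClosed R) (p d : nat)
    (tau : R) (g : 'I_d.+1 -> R) :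
  tau ^+ d.+1 = p%:R -> (forall a, g a \in L) ->
  \sum_a g a * tau ^+ a = 0 -> g 0 ^+ d.+1 \in multiples L p.
Proof.
move=> tau_d gL g0.
pose A := \matrix_(j < d.+1, i < d.+1)
  (if (i <= j)%N then g (j - i) else p%:R * g (j - i)).
have /eqP detA : \det A == 0.
  apply/det0P; exists (\row_j tau ^+ j).
    apply/eqP => /rowP/(_ 0); rewrite !mxE expr0 => /eqP; by rewrite oner_eq0.
  apply/rowP => i; rewrite !mxE.
  (* The wrap-around of the addition in 'I_d.+1 is compensated by tau_d. *)
  rewrite (reindex_inj (addrI i)) /=.
  transitivity (tau ^+ i * \sum_a g a * tau ^+ a); last by rewrite g0 mulr0.
  rewrite mulr_sumr; apply: eq_bigr => a _.
  rewrite !mxE [i + a - i]addrC addKr /=.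
  have [ia|ia] := ltnP (i + a) d.+1.
    by rewrite modn_small // leq_addr exprD; ring.
  have -> : ((i + a) %% d.+1)%N = (i + a - d.+1)%N.
    rewrite -{1}(subnK ia) modnDr modn_small// ltn_subLR//.
    by rewrite -addSn leq_add// ltnW.
  rewrite ifN -?ltnNge ?ltn_subLR//; last by rewrite addnC ltn_add2r.
  by rewrite -tau_d mulrA -exprD subnK// exprD; ring.
rewrite -[g 0 ^+ d.+1]subr0 -detA /determinant (bigD1 1%g)//=.
rewrite odd_perm1 expr0 mul1r.
rewrite opprD addrA.
rewrite (_ : \prod_i A i ((1%g : 'S_d.+1) i) = g 0 ^+ d.+1); last first.
  rewrite -[d.+1 in RHS](card_ord d.+1) -prodr_const; apply: eq_big => // i _.
  by rewrite perm1 mxE leqnn subrr.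
rewrite subrr sub0r rpredN; apply: rpred_sum => s /perm_neq1_gt[i si].
rewrite multiplesMl ?rpredX ?rpredN1// (bigD1 i)//= mulrC multiplesMl//.
  by rewrite rpred_prod// => j _; rewrite mxE; case: ifP; rewrite ?rpredM ?rpred_nat.
by rewrite mxE leqNgt si /=; apply: multiples_natmul.
Qed.

Section FreeExtension.
Variables (R : idomainType) (I : finType) (w : I -> R).
Hypothesis w_1 : exists i, w i = 1.
Hypothesis w_closed : forall i j, exists l (m : nat), w i * w j = m%:R * w l.
Hypothesis w_free : Zfree w.

Definition Zspan : {pred R} :=
  fun x => `[< exists c : I -> int, x = \sum_i (c i)%:~R * w i >].

Lemma ZspanP x :
  reflect (exists c : I -> int, x = \sum_i (c i)%:~R * w i) (x \in Zspan).
Proof. exact: asboolP. Qed.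

Lemma Zspan_gen m i : m%:~R * w i \in Zspan.
Proof.
apply/ZspanP; exists (fun j => m *+ (j == i)).
rewrite (bigD1 i)//= eqxx big1 ?addr0// => j /negPf ->.
by rewrite mulr0n mul0r.
Qed.

Fact Zspan_zmod_closed : zmod_closed Zspan.
Proof.
split=> [|_ _ /ZspanP[a ->] /ZspanP[b ->]]; apply/ZspanP.
  by exists (fun=> 0); rewrite big1// => i _; rewrite mul0r.
exists (fun i => a i - b i); rewrite -sumrB.
by apply: eq_bigr => i _; rewrite intrB mulrBl.
Qed.
HB.instance Definition _ := GRing.isZmodClosed.Build R Zspan Zspan_zmod_closed.

Fact Zspan_mul_closed : mulr_closed Zspan.
Proof.
split=> [|_ _ /ZspanP[a ->] /ZspanP[b ->]].
  by have [i <-] := w_1; rewrite -[w i]mul1r (Zspan_gen 1).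
rewrite mulr_suml rpred_sum// => i _; rewrite mulr_sumr rpred_sum// => j _.
have [l [m wm]] := w_closed i j.
rewrite mulrACA wm mulrA.
by rewrite (_ : _ * m%:R = (a i * b j * m%:Z)%:~R) ?Zspan_gen// !intrM.
Qed.
HB.instance Definition _ := GRing.isMulClosed.Build R Zspan Zspan_mul_closed.

(** Freeness turns divisibility in the span into divisibility of coefficients. *)
Lemma multiples_coef p (c : I -> int) :
  \sum_i (c i)%:~R * w i \in multiples Zspan p ->
  exists b : I -> int, forall i, c i = p%:Z * b i.
Proof.
move=> /multiplesP[_ /ZspanP[b ->] eqcb]; exists b => i.
apply/eqP; rewrite -subr_eq0; apply/eqP; move: i; apply: w_free.
under eq_bigr do rewrite intrB mulrBl.
rewrite sumrB eqcb mulr_sumr -sumrB big1// => i _.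
by rewrite intrM mulrA subrr.
Qed.

Variables (p : nat) (pi : I -> I) (u : I -> nat).
Hypothesis p_pr : prime p.
Hypothesis pi_inj : injective pi.
Hypothesis w_frob : forall i, w i ^+ p = (u i)%:R * w (pi i).
Hypothesis u_p : forall i, ~~ (p %| u i)%N.

(** The p-th power of an element with coefficients c i is congruent modulo p to
    the element with coefficients c i ^ p * u i at the distinct places pi i, so
    it is a multiple of p only if p divides every c i. *)
Lemma multiples_reduced x m : x \in Zspan -> (m <= p)%N ->
  x ^+ m \in multiples Zspan p -> x \in multiples Zspan p.
Proof.
move=> Lx mp xm.
have : x ^+ p \in multiples Zspan p.
  by rewrite -[in x ^+ p](subnK mp) exprD multiplesMl ?rpredX.
have /ZspanP[c xE] := Lx.
have Lc i : (c i)%:~R * w i \in Zspan by exact: Zspan_gen.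
have := frobenius_sum p_pr Lc; rewrite -xE => xpE xp.
have := rpredB xp xpE; rewrite opprB addrC subrK => {xpE xp}.
pose c' i := c (invF pi_inj i) ^+ p * (u (invF pi_inj i))%:Z.
rewrite [X in X \in _](_ : _ = \sum_i (c' i)%:~R * w i); last first.
  rewrite [RHS](reindex_inj pi_inj); apply: eq_bigr => i _.
  by rewrite exprMn w_frob /c' invF_f intrM rmorphXn /= -mulrA.
move=> /multiples_coef[b c'E]; apply/multiplesP.
exists (\sum_i (c i %/ p)%Z%:~R * w i); first by apply/ZspanP; eexists.
rewrite xE mulr_sumr; apply: eq_bigr => i _.
rewrite mulrA; congr (_ * _).
have : (p%:Z %| c i)%Z.
  have := c'E (pi i); rewrite /c' invF_f => cu.
  have : (p%:Z %| c i ^+ p * (u i)%:Z)%Z by rewrite cu dvdz_mulr.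
  rewrite !dvdzE abszM Euclid_dvdM// abszX Euclid_dvdX// (negPf (u_p i)) orbF.
  by case/andP.
by rewrite dvdz_eq => /eqP {1}<-; rewrite intrM mulrC.
Qed.

Variables (d : nat) (tau : R).
Hypothesis tau_d : tau ^+ d.+1 = p%:R.
Hypothesis d_p : (d.+1 <= p)%N.
Let v (x : I * 'I_d.+1) := w x.1 * tau ^+ x.2.

(** Otherwise p times the unit element would be a nontrivial relation. *)
Lemma p_neq0 : p%:R != 0 :> R.
Proof.
have [i wi1] := w_1; apply/negP => /eqP p0.
have /w_free/(_ i) : \sum_j (p%:Z *+ (j == i))%:~R * w j = 0.
  rewrite big1// => j _; have [->|] := eqVneq; last by rewrite mulr0n mul0r.
  by rewrite wi1 mulr1 mulr1n [_%:~R]p0.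
by rewrite eqxx mulr1n => -[] p0'; have := prime_gt0 p_pr; rewrite p0'.
Qed.

(** The constant coefficient of a relation is divisible by p = tau ^ (d + 1), so
    the relation can be divided by tau. *)
Lemma relation_rotate (c : I * 'I_d.+1 -> int) :
  \sum_x (c x)%:~R * v x = 0 ->
  exists c' : I * 'I_d.+1 -> int, 
  [/\ \sum_x (c' x)%:~R * v x = 0,
      forall i, c (i, ord0) = p%:Z * c' (i, ord_max) &
      forall i (a : 'I_d), c (i, lift ord0 a) = c' (i, widen_ord (leqnSn d) a)].
Proof.
move=> cv.
pose g (c : I * 'I_d.+1 -> int) a := \sum_i (c (i, a))%:~R * w i.
have gE b : \sum_x (b x)%:~R * v x = \sum_a g b a * tau ^+ a.
  transitivity (\sum_i \sum_a (b (i, a))%:~R * v (i, a)).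
    by rewrite pair_bigA; apply: eq_bigr => -[].
  rewrite exchange_big; apply: eq_bigr => a _; rewrite mulr_suml.
  by apply: eq_bigr => i _; rewrite mulrA.
have gL a : g c a \in Zspan by apply/ZspanP; eexists.
have g0 : g c 0 \in multiples Zspan p.
  apply: (multiples_reduced (gL _) d_p).
  by apply: (const_coef_exp_multiple tau_d gL); rewrite -gE.
have [b cb] := multiples_coef g0.
pose c' x : int :=
  if unlift ord_max x.2 is Some a then c (x.1, lift ord0 a) else b x.1.
have c'max i : c' (i, ord_max) = b i by rewrite /c' unlift_none.
have c'lift i a : c' (i, widen_ord (leqnSn d) a) = c (i, lift ord0 a).
  rewrite /c' /= (_ : widen_ord _ a = lift ord_max a) ?liftK//.
  exact/val_inj/esym/lift_max.
exists c'; split=> // [|i]; last by rewrite c'max cb.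
have tau0 : tau != 0.
  by apply: contra_neq p_neq0 => tau0; rewrite -tau_d tau0 expr0n.
apply: (mulfI tau0); rewrite mulr0 -[RHS]cv (gE c') (gE c) mulr_sumr.
rewrite big_ord_recr /= big_ord_recl /= addrC; congr (_ + _).
  rewrite mulrCA -exprS tau_d expr0 mulr1 mulr_suml; apply: eq_bigr => i _.
  by rewrite cb c'max intrM; ring.
apply: eq_bigr => a _; rewrite mulrCA -exprS; congr (_ * _).
by apply: eq_bigr => i _; rewrite c'lift.
Qed.

(** After a rotations the coefficient of tau ^ a becomes the constant one, which
    is p times the leading coefficient of the next rotation: each full turn
    gains a factor p, and iterating proves divisibility by all powers of p. *)
Lemma Zfree_adjoin_root : Zfree v.
Proof.
have dvdc s : forall (a : nat) (ad : (a < d.+1)%N) c,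
    \sum_x (c x)%:~R * v x = 0 -> forall i, ((p ^ s)%N %| `|c (i, Ordinal ad)|)%N.
  elim: s => [//|s IHs]; elim=> [|a IHa] ad c /relation_rotate[c' [c'0 c0 cS]] i.
    rewrite (_ : Ordinal ad = ord0) ?c0; last exact: val_inj.
    rewrite abszM expnS dvdn_pmul2l ?prime_gt0//.
    rewrite (_ : ord_max = Ordinal (ltnSn d)) ?IHs//; exact: val_inj.
  rewrite (_ : Ordinal ad = lift ord0 (Ordinal (ad : (a < d)%N))); last exact: val_inj.
  by rewrite cS (_ : widen_ord _ _ = Ordinal (ltnW ad)) ?IHa//; exact: val_inj.
move=> c c0 [i [a ad]]; apply/eqP; rewrite -absz_eq0; apply: contraT.
rewrite -lt0n => ci; have := dvdn_leq ci (dvdc `|c (i, Ordinal ad)|%N a ad c c0 i).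
by rewrite leqNgt ltn_expl ?prime_gt1.
Qed.
End FreeExtension.

(** * Fields generated by radicals *)

Section RadicalSystems.
Variable R : realType.

Definition radical (d r : nat) : R := r%:R `^ d%:R^-1.

Lemma radical1 d : radical d 1 = 1.
Proof. by rewrite /radical powR1. Qed.

Lemma radicalM d r s : radical d (r * s) = radical d r * radical d s.
Proof. by rewrite /radical natrM powRM. Qed.

Lemma radicalXd d r : (0 < d)%N -> radical d (r ^ d) = r%:R.
Proof.
move=> d0; rewrite /radical natrX -powR_mulrn// -powRrM divff ?powRr1//.
by rewrite pnatr_eq0 -lt0n.
Qed.

Lemma radical_expn d r m : radical d (r ^ m) = radical d r ^+ m.
Proof.
by elim: m => [|m IHm]; rewrite ?expr0 ?radical1// expnS radicalM IHm exprS.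
Qed.

Lemma radical_exp d r : (0 < d)%N -> radical d r ^+ d = r%:R.
Proof. by move=> d0; rewrite -radical_expn radicalXd. Qed.

Lemma radical_bounds d r : (0 < d)%N -> (0 < r)%N -> 1 <= radical d r <= r%:R.
Proof.
move=> d0 r0; have r1 : 1 <= radical d r.
  by rewrite -(@ler_pXn2r _ d)// ?nnegrE ?powR_ge0// radical_exp// expr1n ler1n.
by rewrite r1 -(radical_exp r d0) -[leLHS]expr1 ler_weXn2l.
Qed.

(** Radicands whose d-th roots span an order over the integers and are linearly
    independent.  Up to d-th powers they form a group of exponent d on which
    raising to a power prime to d is injective ([rs_pow]): this is what makes the
    order reduced modulo primes that divide neither d nor the radicands. *)
Record radical_system (d : nat) (I : finType) (r : I -> nat) : Prop := {
  rs_gt0 : forall i, (0 < r i)%N;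
  rs_one : exists i, r i = 1%N;
  rs_mul : forall i j, exists l m, (r i * r j = m ^ d * r l)%N;
  rs_pow : forall p, coprime p d -> exists pi u,
    injective pi /\ forall i, (r i ^ p = u i ^ d * r (pi i))%N;
  rs_free : Zfree (fun i => radical d (r i)) }.

Lemma radical_system_unit d : radical_system d (fun _ : unit => 1%N).
Proof.
split; [by [] | by exists tt | | |].
- by move=> _ _; exists tt, 1%N; rewrite exp1n.
- by move=> p _; exists id, (fun=> 1%N); split=> [x y|i]; rewrite ?exp1n.
move=> c; rewrite (bigD1 tt)//= big1 => [|[]//].
by rewrite addr0 radical1 mulr1 => /eqP; rewrite intr_eq0 => /eqP ? [].
Qed.

Lemma radical_system_adjoin d (I : finType) (r : I -> nat) p :
  radical_system d.+1 r -> prime p -> (d.+1 < p)%N ->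
  (forall i, ~~ (p %| r i)%N) ->
  radical_system d.+1 (fun x : I * 'I_d.+1 => r x.1 * p ^ x.2)%N.
Proof.
move=> [r0 r1 rM rX rfree] p_pr dp rp; split.
- by move=> x; rewrite muln_gt0 r0 expn_gt0 prime_gt0.
- by have [i ri] := r1; exists (i, ord0); rewrite ri.
- move=> [i a] [j b] /=; have [l [m rij]] := rM i j.
  exists (l, inord ((a + b) %% d.+1)%N), (m * p ^ ((a + b) %/ d.+1))%N => /=.
  rewrite inordK ?ltn_pmod// mulnACA rij -expnD {1}(divn_eq (a + b) d.+1).
  by rewrite expnMn expnD expnM; ring.
- move=> q qd; have [pi [u [pi_inj piE]]] := rX q qd.
  exists (fun x : I * 'I_d.+1 => (pi x.1, inord ((x.2 * q) %% d.+1)%N)).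
  exists (fun x : I * 'I_d.+1 => u x.1 * p ^ ((x.2 * q) %/ d.+1))%N; split.
    move=> [i a] [j b] /= [/pi_inj -> /(congr1 val)] /=.
    rewrite !inordK ?ltn_pmod// => /eqP abq.
    congr (_, _); apply/val_inj => /=.
    move: abq; wlog ab : a b / (a <= b)%N => [hw|].
      by case: (leqP a b) => [/hw//|/ltnW /hw{}hw /eqP/esym/eqP/hw].
    rewrite eq_sym eqn_mod_dvd ?leq_mul2r ?ab ?orbT// -mulnBl.
    rewrite Gauss_dvdl 1?coprime_sym// => /dvdn_leq.
    case: posnP => [/eqP|_ /(_ isT)].
      by rewrite subn_eq0 => ba _; apply/eqP; rewrite eqn_leq ab ba.
    by have := ltn_ord b; lia.
  move=> [i a] /=; rewrite inordK ?ltn_pmod// expnMn piE -expnM.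
  by rewrite {1}(divn_eq (a * q) d.+1) expnMn expnD expnM; ring.
have pd : coprime p d.+1.
  by rewrite prime_coprime// gtnNdvd.
have [pi [u [pi_inj piE]]] := rX p pd.
move=> c; under eq_bigr do rewrite radicalM radical_expn; move: c.
apply: (@Zfree_adjoin_root R I (fun i => radical d.+1 (r i)) _ _ _ p pi u) => //.
- by have [i ri] := r1; exists i; rewrite ri radical1.
- move=> i j; have [l [m rij]] := rM i j.
  by exists l, m; rewrite -radicalM rij radicalM radicalXd.
- by move=> i; rewrite -radical_expn piE radicalM radicalXd.
- move=> i; apply: contra (rp i) => pu.
  have : (p %| r i ^ p)%N by rewrite piE dvdn_mulr ?dvdn_exp.
  by rewrite Euclid_dvdX// => /andP[].
- exact: radical_exp.
- exact: ltnW.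
Qed.

Lemma leq_fact_exp d : (d`! <= d ^ d)%N.
Proof.
suff: forall m, (m <= d -> m`! <= d ^ m)%N by apply.
elim=> // m IHm md; rewrite factS expnS leq_mul// IHm//; exact: ltnW.
Qed.

(** The auxiliary s is the product of (d + 1)! and of the primes chosen so far.  A
    prime divisor p of s + 1 is new and larger than d + 1, and as p <= s + 1 the
    quantity 2 * s at most squares at each of the t steps. *)
Lemma radical_system_exists d t : exists (I : finType) (r : I -> nat),
  [/\ radical_system d.+1 r, #|I| = (d.+1 ^ t)%N
    & forall i, (r i <= (2 * d.+1 ^ d.+1) ^ (2 ^ t * d.+1))%N].
Proof.
suff: exists (I : finType) (r : I -> nat) (s : nat),
    [/\ radical_system d.+1 r, #|I| = (d.+1 ^ t)%N,
     ((d.+1)`! %| s)%N /\ (0 < s)%N, (2 * s <= (2 * d.+1 ^ d.+1) ^ (2 ^ t))%N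
    & forall i, (r i <= s ^ d.+1)%N /\
        forall q, prime q -> (q %| r i -> q %| s)%N].
  case=> I [r [s [rs rI _ s_le r_le]]]; exists I, r; split=> // i.
  rewrite (leq_trans (r_le i).1)// [leqRHS]expnM leq_exp2r//.
  by rewrite (leq_trans _ s_le)// leq_pmull.
elim: t => [|t [I [r [s [rs rI [ds s0] s_le r_le]]]]].
  exists unit, (fun=> 1%N), (d.+1)`!; split.
  - exact: radical_system_unit.
  - by rewrite card_unit.
  - by rewrite fact_gt0.
  - by rewrite expn1 leq_mul2l leq_fact_exp.
  - move=> _; rewrite expn_gt0 fact_gt0; split=> // q /prime_gt1.
    by rewrite dvdn1; case: q => [|[]].
pose p := pdiv s.+1; have p_pr : prime p by rewrite pdiv_prime.
have ps : ~~ (p %| s)%N.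
  rewrite -prime_coprime//; apply: (@coprime_dvdl _ s.+1); first exact: pdiv_dvd.
  exact: coprimeSn.
exists (I * 'I_d.+1)%type, (fun x : I * 'I_d.+1 => r x.1 * p ^ x.2)%N, (s * p)%N.
split.
- apply: radical_system_adjoin => //.
    rewrite ltnNge; apply: contra ps => pd; apply: dvdn_trans ds.
    by rewrite dvdn_fact// prime_gt0.
  by move=> i; apply: contra ps => /((r_le i).2 p p_pr).
- by rewrite card_prod rI card_ord expnSr.
- by rewrite dvdn_mulr// muln_gt0 s0 prime_gt0.
- rewrite [(2 ^ t.+1)%N]expnSr [leqRHS]expnM -mulnn.
  rewrite (leq_trans _ (leq_mul s_le s_le))//.
  have : (p <= s.+1)%N by apply: pdiv_leq.
  nia.
- move=> [i a] /=; split.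
    rewrite expnMn leq_mul ?(r_le i).1// leq_pexp2l ?prime_gt0//.
    by rewrite ltnW.
  move=> q q_pr; rewrite Euclid_dvdM// => /orP[/((r_le i).2 q q_pr)|].
    by move=> qs; rewrite dvdn_mulr.
  by rewrite Euclid_dvdX// => /andP[qp _]; rewrite dvdn_mull.
Qed.

End RadicalSystems.

(** * Sums of radicals near a given number *)

(** Approximating alpha minus H + 1 times each irrational radical, with H a bound
    of the coefficients, makes the coefficients positive after adding H + 1.
    The positive coefficients then enter the roots as d-th powers. *)
Lemma radical_sum_approx (R : realType) (d : nat) (I : finType) (r : I -> nat)
    (P X : nat) (alpha : R) : (0 < d)%N ->
  radical_system R d r -> (forall i, r i <= P)%N -> (0 < X)%N ->
  exists (s : seq nat) (z : int),
    [/\ size s = #|I|.-1,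
        all (fun m => 0 < m <= (3 * #|I| ^ 3 * P ^ 3 * X) ^ d * P)%N s
      & `|\sum_(m <- s) radical R d m + z%:~R - alpha| <=
          (#|I| * P)%:R * X%:R ^- #|I|.-1].
Proof.
move=> d0 rs rP X0; have [i1 ri1] := rs_one rs.
set N := #|I|; pose q (i : 'I_N) := r (enum_val i).
pose w i := radical R d (q i); pose i0 : 'I_N := enum_rank i1.
have q0 i : (0 < q i)%N by exact: rs_gt0 rs _.
have w_i0 : w i0 = 1 by rewrite /w /q enum_rankK ri1 radical1.
have w_bounds i : 1 <= w i <= P%:R.
  have /andP[-> wr] := radical_bounds R d0 (q0 i).
  by rewrite (le_trans wr)// ler_nat rP.
have w_closed i j : exists l (m : nat), w i * w j = m%:R * w l.
  have [l [m rij]] := rs_mul rs (enum_val i) (enum_val j).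
  by exists (enum_rank l), m; rewrite /w /q enum_rankK -radicalM rij radicalM radicalXd.
have w_free : Zfree w.
  move=> c c0 i; rewrite -(enum_valK i).
  apply: (rs_free rs (c := fun i => c (enum_rank i))).
  rewrite (reindex (fun j : 'I_N => enum_val j))/=; last first.
    by exists enum_rank => x _; rewrite ?enum_valK ?enum_rankK.
  by rewrite -[RHS]c0; apply: eq_bigr => j _; rewrite enum_valK.
pose H := (N ^ 3 * P ^ 3 * X)%N.
have [c [cH capprox]] := inhomogeneous w_i0 w_bounds w_closed w_free
  (alpha - \sum_(i | i != i0) H.+1%:R * w i) X0.
rewrite -/H in cH.
pose e i := absz (c i + H.+1%:Z).
have eE i : i != i0 -> (e i)%:R = (c i)%:~R + H.+1%:R :> R.
  move=> /cH ciH; have : (e i)%:Z = c i + H.+1%:Z.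
    by rewrite /e gez0_abs//; lia.
  by move=> /(congr1 (intr : int -> R)); rewrite rmorphD.
exists [seq (e i ^ d * q i)%N | i <- enum (predC1 i0)], (c i0); split.
- by rewrite size_map -cardE cardC1 card_ord.
- apply/allP => _ /mapP[i ii0 ->]; rewrite mem_enum in ii0.
  have P0 : (0 < P)%N := leq_trans (q0 i) (rP _).
  have N0 : (0 < N)%N by apply: leq_ltn_trans (ltn_ord i).
  have H0 : (0 < H)%N by rewrite !muln_gt0 ?expn_gt0 ?N0 ?P0 ?X0.
  have := cH i ii0 => ciH.
  rewrite muln_gt0 expn_gt0 q0 andbT /= leq_mul ?rP ?andbT//.
    by apply/orP; left; rewrite /e; lia.
  rewrite leq_exp2r// (_ : _ * X = 3 * H)%N; last by rewrite /H; ring.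
  by rewrite /e; lia.
- rewrite big_map big_enum /=; move: capprox.
  rewrite cardC1 card_ord (bigD1 i0)//= w_i0 mulr1; congr (`|_| <= _).
  under [in RHS]eq_bigr => i ii0 do rewrite radicalM radicalXd// -/(w i) eE// mulrDl.
  by rewrite big_split /=; ring.
Qed.

Lemma dist_int_le1 (R : realType) (x : R) : dist_int x <= 1.
Proof.
apply: le_trans ((dist_int_min x).2 (Num.floor x)) _.
have /andP[fx xf] := floor_itv x.
by rewrite ger0_norm ?subr_ge0// lerBlDl -intrD1 ltW.
Qed.

Lemma gammaE (R : realType) (k d : nat) : (1 < d)%N ->
  gamma R k d = (d ^ trunc_log d k.+1).-1%:R / d%:R.
Proof.
move=> d1; have /andP[tk kt] := trunc_log_bounds d1 (ltn0Sn k).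
set t := trunc_log _ _ in tk kt *.
have d0 : 0 < d%:R :> R by rewrite ltr0n ltnW.
have lnd : 0 < ln (d%:R : R) by rewrite ln_gt0// ltr1n.
rewrite /gamma /logb (@floor_def _ _ t%:Z).
  by rewrite -exprnP -natrX -subn1 natrB// expn_gt0 ltnW.
rewrite intrD1 -pmulrn natr1 ler_pdivlMr// ltr_pdivrMr//.
rewrite !mulr_natl -!lnXn// -!natrX.
by rewrite ler_ln ?ltr_ln ?posrE ?ltr0n ?expn_gt0 ?(ltnW d1)// ler_nat ltr_nat tk kt.
Qed.

(** By maximality of the logarithm, d ^ (t + 1) is larger than k + 1. *)
Lemma gamma_ge (R : realType) (k d : nat) : (1 < d)%N ->
  (k%:R - d%:R + 1) / d%:R ^+ 2 <= gamma R k d.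
Proof.
move=> d1; have /andP[tk kt] := trunc_log_bounds d1 (ltn0Sn k).
have d0 : 0 < d%:R :> R by rewrite ltr0n ltnW.
rewrite gammaE// expr2 invfM mulrA ler_pM2r ?invr_gt0// ler_pdivrMr//.
rewrite -subn1 natrB ?expn_gt0 ?(ltnW d1)// mulrBl mul1r -natrM -expnSr.
have : k.+1%:R <= (d ^ (trunc_log d k.+1).+1)%:R :> R by rewrite ler_nat ltnW.
by rewrite -natr1; lra.
Qed.

(** * The constant and its computability *)

(** The bound of [radical_system_exists], with 2 ^ t <= d ^ t <= k + 1. *)
Definition radicand_bound (k d : nat) : nat := ((2 * d ^ d) ^ (k.+1 * d))%N.

(** The roots with coefficients of size X have radicands at most
    X ^ d * size_bound k d, by [radical_sum_approx] with #|I| <= k + 1. *)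
Definition size_bound (k d : nat) : nat :=
  ((3 * k.+1 ^ 3 * radicand_bound k d ^ 3) ^ d * radicand_bound k d)%N.

Definition approx_const (k d : nat) : nat :=
  ((k.+1 * radicand_bound k d) * (2 * size_bound k d) ^ k)%N.

Lemma radicand_bound_gt0 k d : (0 < d)%N -> (0 < radicand_bound k d)%N.
Proof. by move=> d0; rewrite expn_gt0 muln_gt0 expn_gt0 d0. Qed.

Lemma size_bound_gt0 k d : (0 < d)%N -> (0 < size_bound k d)%N.
Proof.
move=> /(radicand_bound_gt0 k) P0.
apply: (leq_mul (_ : 0 < (3 * k.+1 ^ 3 * radicand_bound k d ^ 3) ^ d)%N P0).
by rewrite expn_gt0 muln_gt0 [(0 < _ ^ 3)%N]expn_gt0 P0.
Qed.

Lemma approx_const_gt0 k d : (0 < d)%N -> (0 < approx_const k d)%N.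
Proof.
move=> d0; apply: (leq_mul (leq_mul (ltn0Sn k) (radicand_bound_gt0 k d0))
  (_ : 0 < (2 * size_bound k d) ^ k)%N).
by rewrite expn_gt0 muln_gt0 size_bound_gt0.
Qed.

Section RecursiveArithmetic.
Local Open Scope nat_scope.
Lemma recursive_comp2 (op : nat -> nat -> nat) n (f g : n.-tuple nat -> nat) :
  recursive (fun v : 2.-tuple nat => op (tnth v ord0) (tnth v ord_max)) ->
  recursive f -> recursive g -> recursive (fun v => op (f v) (g v)).
Proof.
move=> rop rf rg.
have rt (i : 'I_2) : recursive (tnth [tuple f; g] i).
  by case: i => [[|[|//]] i2].
have := recursive_comp rop rt.
by congr recursive; apply/funext => v; rewrite !tnth_mktuple.
Qed.

Lemma recursive_S n (f : n.-tuple nat -> nat) :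
  recursive f -> recursive (fun v => (f v).+1).
Proof.
move=> rf; have := recursive_comp recursive_succ (fun _ : 'I_1 => rf).
by congr recursive; apply/funext => v; rewrite /thead tnth_mktuple.
Qed.

Lemma recursive_const n c : @recursive n (fun=> c).
Proof. by elim: c => [|c ih]; [exact: recursive_zero | exact: recursive_S]. Qed.

(** Primitive recursion on the first of two arguments. *)
Lemma recursive_binary (op : nat -> nat -> nat)
    (f : 1.-tuple nat -> nat) (g : 3.-tuple nat -> nat) :
  recursive f -> recursive g ->
  (forall x, op 0 x = f [tuple x]) ->
  (forall y x, op y.+1 x = g [tuple y; op y x; x]) ->
  recursive (fun v : 2.-tuple nat => op (tnth v ord0) (tnth v ord_max)).
Proof.
move=> rf rg op0 opS; apply: (recursive_primrec rf rg) => [v|y v].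
  by case/tupleP: v => x v; rewrite (tuple0 v) [LHS]op0; congr f; apply: val_inj.
case/tupleP: v => x v; rewrite (tuple0 v) [LHS]opS.
by congr g; apply: val_inj.
Qed.

Lemma recursive_add n (f g : n.-tuple nat -> nat) :
  recursive f -> recursive g -> recursive (fun v => f v + g v).
Proof.
apply: recursive_comp2.
by apply: (recursive_binary (op := addn) (recursive_proj ord0)
  (recursive_S (recursive_proj (inord 1)))) => [x|y x] //;
  rewrite (tnth_nth 0) ?inordK.
Qed.

Lemma recursive_mul n (f g : n.-tuple nat -> nat) :
  recursive f -> recursive g -> recursive (fun v => f v * g v).
Proof.
apply: recursive_comp2.
apply: (recursive_binary (op := muln) (recursive_const 1 0)
  (recursive_add (recursive_proj ord_max) (recursive_proj (inord 1)))) => [x|y x] //.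
by rewrite !(tnth_nth 0) ?inordK.
Qed.

Lemma recursive_exp n (f g : n.-tuple nat -> nat) :
  recursive f -> recursive g -> recursive (fun v => f v ^ g v).
Proof.
move=> rf rg; apply: (recursive_comp2 (op := fun y x => x ^ y)) rg rf.
apply: (recursive_binary (op := fun y x => x ^ y) (recursive_const 1 1)
  (recursive_mul (recursive_proj ord_max) (recursive_proj (inord 1)))) => [x|y x] //.
by rewrite !(tnth_nth 0) ?inordK // expnS.
Qed.

End RecursiveArithmetic.

(** A natural number is approximated exactly, by its product with m + 1 over
    m + 1. *)
Lemma effective_approx_const (R : realType) :
  effective (fun k d => (approx_const k d)%:R : R).
Proof.
have rproj i : recursive (fun v : 3.-tuple nat => tnth v i) by constructor.
exists (fun v : 3.-tuple nat =>
  approx_const (tnth v ord0) (tnth v (inord 1)) * (tnth v (inord 2)).+1)%N,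
  (fun=> 0%N).
split.
- rewrite /approx_const /size_bound /radicand_bound.
  by repeat first [apply: recursive_mul | apply: recursive_exp | apply: rproj
    | apply: recursive_const | apply: recursive_S].
- exact: recursive_zero.
- move=> k d m; rewrite !(tnth_nth 0%N _ (inord _)) !inordK//= subr0.
  rewrite natrM mulfK ?pnatr_eq0// subrr normr0 invr_ge0; exact: ler0n.
Qed.

(** * The approximation theorem *)

(** The coefficient range X is the largest one that keeps the radicands below n,
    so that n ^ (1 / d) <= 2 * size_bound k d * X.  The k - (d ^ t - 1) spare
    roots are set to 1, which contributes an integer. *)
Lemma approx_constP (R : realType) (k d : nat) (alpha : R) (n : nat) :
  (1 < d)%N -> (0 < n)%N ->
  exists b : 'I_k -> nat,
    (forall j, 1 <= b j <= n)%N /\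
    dist_int (\sum_(j < k) radical R d (b j) - alpha)
      <= (approx_const k d)%:R * n%:R `^ (- gamma R k d).
Proof.
move=> d1 n0; have d0 := ltnW d1; set t := trunc_log d k.+1.
have /andP[tk _] := trunc_log_bounds d1 (ltn0Sn k); rewrite -/t in tk.
set P := radicand_bound k d; set Y := size_bound k d.
have P0 : (0 < P)%N by exact: radicand_bound_gt0.
have Y0 : (0 < Y)%N by exact: size_bound_gt0.
set rho := radical R d n; have /andP[rho1 rho_n] := radical_bounds R d0 n0.
have -> : n%:R `^ (- gamma R k d) = rho ^- (d ^ t).-1.
  rewrite powRN gammaE// -/t mulrC powRrM powR_mulrn ?powR_ge0//.
have C1 : 1 <= (approx_const k d)%:R :> R by rewrite ler1n approx_const_gt0.
have Kk : ((d ^ t).-1 <= k)%N by rewrite -ltnS prednK// expn_gt0 d0.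
set K := _.-1 in Kk *.
have rhoK : 0 < rho ^+ K by rewrite exprn_gt0 // (lt_le_trans ltr01).
(* For small n the bound exceeds 1 and any choice of b will do. *)
have [Yn|nY] := leqP Y n; last first.
  exists (fun=> 1%N); split=> [j|]; first by rewrite n0.
  apply: le_trans (dist_int_le1 _) _.
  rewrite ler_pdivlMr// mul1r natrM natrX.
  apply: (@le_trans _ _ ((2 * Y)%:R ^+ k)); last first.
    by rewrite ler_peMl ?exprn_ge0// ler1n muln_gt0.
  apply: (@le_trans _ _ ((2 * Y)%:R ^+ K)); last first.
    by rewrite ler_weXn2l// ler1n muln_gt0.
  rewrite lerXn2r ?nnegrE ?ler0n ?powR_ge0//.
  by rewrite (le_trans rho_n)// ler_nat; lia.
have [d' dE] : exists d', d = d'.+1 by exists d.-1; rewrite prednK.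
have exX : exists X, (X ^ d * Y <= n)%N by exists 0%N; rewrite exp0n.
have ubX X : (X ^ d * Y <= n)%N -> (X <= n)%N.
  move=> XYn; apply: leq_trans XYn.
  rewrite (leq_trans _ (leq_pmulr _ Y0))// -{1}[X]expn1.
  by case: X => // X; rewrite leq_pexp2l.
have [X XYn maxX] := ex_maxnP exX ubX.
have X0 : (0 < X)%N by apply: maxX; rewrite exp1n mul1n.
have nX : (n < X.+1 ^ d * Y)%N.
  by rewrite ltnNge; apply/negP => /maxX; rewrite ltnn.
have rhoX : rho <= (2 * Y)%:R * X%:R.
  rewrite -(@ler_pXn2r _ d)// ?nnegrE ?powR_ge0// radical_exp// -natrM -natrX ler_nat.
  rewrite (leq_trans (ltnW nX))// mulnAC expnMn leq_mul//.
    by rewrite leq_exp2r//; lia.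
  by rewrite -{1}[Y]expn1 leq_pexp2l.
have [I [r [rs rI r_le]]] := radical_system_exists R d' t.
rewrite -dE in rs rI r_le.
have rP i : (r i <= P)%N.
  apply: leq_trans (r_le i) _; rewrite leq_pexp2l ?muln_gt0 ?expn_gt0 ?d0//.
  rewrite leq_mul2r (leq_trans _ tk) ?orbT//.
  by case: (t) => // t'; rewrite leq_exp2r.
have [s [z [s_size /allP s_bound s_approx]]] :=
  radical_sum_approx alpha d0 rs rP X0.
rewrite rI -/K in s_size s_bound s_approx.
pose b (j : 'I_k) := nth 1%N s j.
exists b; split=> [j|].
  rewrite /b; have [js|js] := ltnP j (size s); last by rewrite nth_default ?n0.
  have /andP[-> sj_le] := s_bound _ (mem_nth 1%N js).
  rewrite (leq_trans sj_le)// (leq_trans _ XYn)// [leqRHS]mulnA -expnMn leq_mul2r.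
  rewrite leq_exp2r// mulnC leq_mul2l; apply/orP; right; apply/orP; right.
  by rewrite !leq_mul// leq_exp2r.
have -> : \sum_(j < k) radical R d (b j) =
    \sum_(m <- s) radical R d m + (k - K)%:R.
  rewrite -(big_mkord xpredT (fun j => radical R d (nth 1%N s j))).
  rewrite (@big_cat_nat _ _ _ K)//=; congr (_ + _).
    by rewrite [RHS](big_nth 1%N) s_size.
  rewrite -[RHS]mulr1 mulr_natl -sumr_const_nat; apply: eq_big_nat => j /andP[Kj _].
  by rewrite nth_default ?radical1// s_size.
apply: le_trans ((dist_int_min _).2 ((k - K)%:Z - z)) _.
rewrite (_ : _ - _ = \sum_(m <- s) radical R d m + z%:~R - alpha); last first.
  by rewrite intrB -pmulrn; ring.
apply: le_trans s_approx _.
rewrite /approx_const -/P -/Y [in leRHS]natrM -[leRHS]mulrA.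
apply: ler_pM => //; first by rewrite ler_nat leq_mul2r tk orbT.
rewrite ler_pdivlMr// mulrC ler_pdivrMr ?exprn_gt0 ?ltr0n//.
apply: (@le_trans _ _ (((2 * Y)%:R * X%:R) ^+ K)).
  by rewrite lerXn2r ?nnegrE ?powR_ge0 ?mulr_ge0.
rewrite exprMn ler_wpM2r ?exprn_ge0// natrX ler_weXn2l// ler1n.
by rewrite muln_gt0.
Qed.

Theorem theorem1p1 (R : realType) :
  exists C : nat -> nat -> R,
    effective C /\
    forall k d : nat, (1 <= k)%N -> (2 <= d)%N ->
      [/\ 0 < C k d,
          forall (alpha : R) (n : nat), (1 <= n)%N ->
            exists b : 'I_k -> nat,
              (forall j, (1 <= b j <= n)%N) /\
              dist_int (\sum_(j < k) (b j)%:R `^ (d%:R^-1) - alpha)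
                <= C k d * n%:R `^ (- gamma R k d)
        & (k%:R - d%:R + 1) / d%:R ^+ 2 <= gamma R k d].
Proof.
exists (fun k d => (approx_const k d)%:R); split.
  exact: effective_approx_const.
move=> k d _ d2; split.
- by rewrite ltr0n approx_const_gt0 // ltnW.
- by move=> alpha n n0; exact: approx_constP.
- exact: gamma_ge.
Qed.
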